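(* Let $D$ be the graph obtained from $K_4$ by deleting one edge, and let $K_3\sqcup K_2$ be the disjoint union of a triangle and a single edge. Then $(D,K_3\sqcup K_2)$ is $(p,1-p)$-common for $p=\frac{8-2\sqrt{10}}{3}$.
   Context: Graphs are finite and simple; $e(H)$ is the number of edges. A graphon is a symmetric measurable $W:[0,1]^2\to[0,1]$, and $t(H,W):=\int_{[0,1]^{V(H)}}\prod_{uv\in E(H)}W(x_u,x_v)\prod_{v}dx_v$. For $p_1,p_2\in(0,1)$ with $p_1+p_2=1$, a pair $(H_1,H_2)$ of graphs with at least one edge each is $(p_1,p_2)$-common if for all graphons $W_1,W_2$ with $W_1+W_2=1$, \[\frac{t(H_1,W_1)}{e(H_1)p_1^{e(H_1)-1}}+\frac{t(H_2,W_2)}{e(H_2)p_2^{e(H_2)-1}}\geq \frac{p_1}{e(H_1)}+\frac{p_2}{e(H_2)}.\] *)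

(* Defs.v *)
From HB Require Import structures.
From mathcomp Require Import all_boot all_order all_algebra.
From mathcomp Require Import all_classical all_reals all_analysis.

Set Implicit Arguments.
Unset Strict Implicit.
Unset Printing Implicit Defensive.

Import Order.TTheory GRing.Theory Num.Theory.
Import numFieldNormedType.Exports.

Local Open Scope classical_set_scope.
Local Open Scope ring_scope.

Record sgraph := SGraph {
  vertex :> finType;
  adj : rel vertex;
  adj_sym : symmetric adj;
  adj_irr : irreflexive adj }.

Arguments adj {_} _ _.

(* Each edge {u, v} is listed once, as the pair (u, v) whose first component
   comes first in the enumeration of the vertices. *)
Definition edges (H : sgraph) : {set H * H} :=
  [set uv | adj uv.1 uv.2 & (enum_rank uv.1 < enum_rank uv.2)%N].

Definition nedges (H : sgraph) : nat := #|edges H|.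

Section complete.
Variable n : nat.

Let cadj : rel 'I_n := fun u v => u != v.

Fact complete_sym : symmetric cadj.
Proof. by move=> u v; rewrite /cadj eq_sym. Qed.

Fact complete_irr : irreflexive cadj.
Proof. by move=> u; rewrite /cadj eqxx. Qed.

Definition complete : sgraph := SGraph complete_sym complete_irr.

End complete.

Section delete_edge.
Variables (H : sgraph) (a b : H).

Let dadj : rel H := fun u v => adj u v && ([set u; v] != [set a; b])%SET.

Fact delete_edge_sym : symmetric dadj.
Proof. by move=> u v; rewrite /dadj adj_sym finset.setUC. Qed.

Fact delete_edge_irr : irreflexive dadj.
Proof. by move=> u; rewrite /dadj adj_irr. Qed.

Definition delete_edge : sgraph := SGraph delete_edge_sym delete_edge_irr.

End delete_edge.

Section disjoint_union.
Variables H1 H2 : sgraph.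

Let uadj : rel (H1 + H2)%type := fun x y =>
  match x, y with
  | inl u, inl v => adj u v
  | inr u, inr v => adj u v
  | _, _ => false
  end.

Fact disjoint_union_sym : symmetric uadj.
Proof. by case=> u [] v //=; rewrite adj_sym. Qed.

Fact disjoint_union_irr : irreflexive uadj.
Proof. by case=> u /=; rewrite adj_irr. Qed.

Definition disjoint_union : sgraph :=
  SGraph disjoint_union_sym disjoint_union_irr.

End disjoint_union.

(* By symmetry of K_4 the choice of the deleted edge is immaterial. *)
Definition K4_minus_edge : sgraph :=
  @delete_edge (complete 4) (ord0 : 'I_4) (ord_max : 'I_4).

Definition K3_disjoint_K2 : sgraph := disjoint_union (complete 3) (complete 2).

Section tuple_cons.
Context (d : measure_display) (T : measurableType d) (n : nat).

Definition tcons (xt : T * n.-tuple T) : n.+1.-tuple T :=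
  [the n.+1.-tuple T of xt.1 :: xt.2].

Definition tuncons (t : n.+1.-tuple T) : T * n.-tuple T :=
  (thead t, [tuple of behead t]).

Lemma tconsK : cancel tcons tuncons.
Proof. by case=> x t; rewrite /tuncons theadE; congr pair; apply: val_inj. Qed.

Lemma measurable_tcons : measurable_fun [set: T * n.-tuple T] tcons.
Proof. by apply: measurable_cons. Qed.

Lemma measurable_tuncons : measurable_fun [set: n.+1.-tuple T] tuncons.
Proof.
apply/measurable_fun_pairP; split; first exact: measurable_tnth.
exact: measurable_behead.
Qed.

End tuple_cons.

Section power_measure_succ.
Local Open Scope ereal_scope.
Context (d : measure_display) (T : measurableType d) (R : realType) (n : nat).
Variables (mu : {sigma_finite_measure set T -> \bar R}).
Variables (nu : {sigma_finite_measure set (n.-tuple T) -> \bar R}).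

Definition power_measure_succ : set (n.+1.-tuple T) -> \bar R :=
  pushforward (mu \x nu) (@tcons d T n).

Let pms0 : power_measure_succ set0 = 0.
Proof. by rewrite /power_measure_succ /pushforward preimage_set0 measure0. Qed.

Let pms_ge0 A : 0 <= power_measure_succ A.
Proof. by rewrite /power_measure_succ /pushforward measure_ge0. Qed.

Let mpre (A : set (n.+1.-tuple T)) :
  measurable A -> measurable (@tcons d T n @^-1` A).
Proof. by move=> mA; rewrite -[X in measurable X]setTI; exact: measurable_tcons. Qed.

Let pms_sigma_additive : semi_sigma_additive power_measure_succ.
Proof.
move=> F mF tF mUF; rewrite /power_measure_succ /pushforward preimage_bigcup.
apply: measure_semi_sigma_additive.
- by move=> k; exact: mpre.
- apply/trivIsetP => /= i j _ _ ij; rewrite -preimage_setI.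
  by move/trivIsetP : tF => /(_ _ _ _ _ ij) ->//; rewrite preimage_set0.
- by rewrite -preimage_bigcup; exact: mpre.
Qed.

HB.instance Definition _ := isMeasure.Build _ _ _ power_measure_succ
  pms0 pms_ge0 pms_sigma_additive.

Let pms_sigma_finite : sigma_finite [set: n.+1.-tuple T] power_measure_succ.
Proof.
have /sigma_finiteP[F [UF ndF mF]] := sigma_finiteT mu.
have /sigma_finiteP[G [UG ndG mG]] := sigma_finiteT nu.
exists (fun k => @tuncons d T n @^-1` (F k `*` G k)).
  apply/seteqP; split=> // t _.
  have [i _ Fi] : (\bigcup_i F i) (tuncons t).1 by rewrite -UF.
  have [j _ Gj] : (\bigcup_i G i) (tuncons t).2 by rewrite -UG.
  exists (maxn i j) => //; split.
    by move: Fi; exact/subsetPset/ndF/leq_maxl.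
  by move: Gj; exact/subsetPset/ndG/leq_maxr.
move=> k; have [mFk Fkoo] := mF k; have [mGk Gkoo] := mG k; split.
  rewrite -[X in measurable X]setTI; apply: measurable_tuncons => //.
  exact: measurableX.
rewrite /power_measure_succ /pushforward.
rewrite (_ : _ @^-1` _ = F k `*` G k).
  by rewrite product_measure1E// lte_mul_pinfty// ge0_fin_numE.
by apply/seteqP; split=> x; rewrite /preimage /mkset tconsK.
Qed.

HB.instance Definition _ := Measure_isSigmaFinite.Build _ _ _
  power_measure_succ pms_sigma_finite.

End power_measure_succ.

Fixpoint power_measure (d : measure_display) (T : measurableType d)
    (R : realType) (mu : {sigma_finite_measure set T -> \bar R}) (n : nat) :
    {sigma_finite_measure set (n.-tuple T) -> \bar R} :=
  match n with
  | 0 => [the {sigma_finite_measure set (0.-tuple T) -> \bar R} of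
            \d_([tuple] : 0.-tuple T)]
  | n.+1 => [the {sigma_finite_measure set (n.+1.-tuple T) -> \bar R} of
            power_measure_succ mu (power_measure mu n)]
  end.

Lemma power_measure_box (d : measure_display) (T : measurableType d)
    (R : realType) (mu : {sigma_finite_measure set T -> \bar R}) (n : nat)
    (A : 'I_n -> set T) : (forall i, measurable (A i)) ->
  power_measure mu n [set x | forall i, A i (tnth x i)] =
  (\prod_(i < n) mu (A i))%E.
Proof.
elim: n A => [|n IHn] A mA.
  rewrite big_ord0 /= diracE (_ : _ \in _ = true)//.
  by apply/mem_set => -[].
rewrite big_ord_recl /= /power_measure_succ /pushforward.
rewrite (_ : _ @^-1` _ =
  A ord0 `*` [set x : n.-tuple T | forall i, A (lift ord0 i) (tnth x i)]).
  rewrite product_measure1E//=; last first.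
    rewrite (_ : [set x : n.-tuple T | _] =
        \big[setI/setT]_(i < n) (@tnth n T ^~ i @^-1` A (lift ord0 i))).
      apply: bigsetI_measurable => i _; rewrite -[X in measurable X]setTI.
      exact: measurable_tnth.
    rewrite -bigcap_seq; apply/seteqP; split=> x /= h i.
      by move=> _; exact: h.
    by apply: h; rewrite /= mem_index_enum.
  by congr (_ * _)%E; apply: (IHn (fun i => A (lift ord0 i))).
apply/seteqP; split=> [[x t]|[x t]] /=.
  move=> h; split; first exact: (h ord0).
  by move=> i; have := h (lift ord0 i); rewrite tnthS.
move=> [h0 h] i; case: (unliftP ord0 i) => [j ->|->//].
by rewrite tnthS.
Qed.

Section graphons.
Variable R : realType.

Definition unit_interval : set R := `[0, 1].

Definition graphon (W : R * R -> R) : Prop :=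
  [/\ measurable_fun (unit_interval `*` unit_interval
        : set (measurableTypeR R * measurableTypeR R)) W,
      (forall x y : R, unit_interval x -> unit_interval y -> W (x, y) = W (y, x)) &
      (forall x y : R, unit_interval x -> unit_interval y -> 0 <= W (x, y) <= 1)].

Definition cube (n : nat) : set (n.-tuple R) :=
  [set x | forall i, unit_interval (tnth x i)].

(* [0,1]^{V(H)} is encoded as the cube in R^{|V(H)|}, the vertex v indexing
   the coordinate enum_rank v. *)
Definition hom_density (H : sgraph) (W : R * R -> R) : R :=
  \int[power_measure (@lebesgue_measure R) #|H|]_(x in @cube #|H|)
    \prod_(uv in edges H) W (tnth x (enum_rank uv.1), tnth x (enum_rank uv.2)).

Definition common (p1 p2 : R) (H1 H2 : sgraph) : Prop :=
  [/\ 0 < p1 < 1, 0 < p2 < 1, p1 + p2 = 1,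
      (0 < nedges H1)%N /\ (0 < nedges H2)%N &
      forall W1 W2 : R * R -> R, graphon W1 -> graphon W2 ->
        (forall x y : R, unit_interval x -> unit_interval y ->
          W1 (x, y) + W2 (x, y) = 1) ->
        hom_density H1 W1 / ((nedges H1)%:R * p1 ^+ (nedges H1).-1) +
        hom_density H2 W2 / ((nedges H2)%:R * p2 ^+ (nedges H2).-1)
        >= p1 / (nedges H1)%:R + p2 / (nedges H2)%:R].

End graphons.

(* Main.v *)
Require Import Defs.
From HB Require Import structures.
From mathcomp Require Import all_boot all_order all_algebra.
From mathcomp Require Import all_classical all_reals all_analysis.
From mathcomp Require Import measurable_realfun.
From mathcomp Require Import ring lra.

(** Write W for W_1 and let e, s, T be its edge, cherry and triangle densities
    and c(x, y) its codegree. Then t(D, W) is the integral of W c^2, so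
    integrating W (c - l)^2 >= 0 gives t(D, W) >= 2 l T - l^2 e for every l.
    Moreover t(K_3, 1 - W) = 1 - 3 e + 3 s - T, s >= e^2 and T >= 2 s - e.
    The number p is the root in (0, 1) of 3 p^2 - 16 p + 8, i.e. of
    5 p^2 = 8 (1 - p)^2, for which e = p, T = p^3 is a critical point of the resulting bound.
    If e <= 16/25, the l that cancels T leaves (e - p)^2 times a positive affine
    function of e; if e >= 16/25, take l = 2 e - 1 and T >= 2 e^2 - e. *)

Set Implicit Arguments.
Unset Strict Implicit.
Unset Printing Implicit Defensive.

Import Order.TTheory GRing.Theory Num.Theory.
Import numFieldNormedType.Exports.

Local Open Scope classical_set_scope.
Local Open Scope ring_scope.

(** * Bounded measurable functions *)

Section bounded_measurable.
Context {R : realType}.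

(** Boundedness and measurability on the whole space are stable under products, composition and
    partial integration over sets of finite measure, and give integrability on measurable sets of
    finite measure. This one predicate thus supplies the side conditions of linearity and Fubini. *)
Definition bmeas (d : measure_display) (T : measurableType d) (f : T -> R) :=
  measurable_fun [set: T] f /\ exists M : R, forall x, `|f x| <= M.

Section closure.
Context (d : measure_display) (T : measurableType d).
Implicit Types f g : T -> R.

Lemma bmeas_cst (r : R) : bmeas (fun _ : T => r).
Proof. by split; [exact: measurable_cst|exists `|r|]. Qed.

Lemma bmeasD f g : bmeas f -> bmeas g -> bmeas (fun x => f x + g x).
Proof.
move=> [mf [M fM]] [mg [N gN]]; split; first exact: measurable_funD.
by exists (M + N) => x; rewrite (le_trans (ler_normD _ _))// lerD.
Qed.

Lemma bmeasM f g : bmeas f -> bmeas g -> bmeas (fun x => f x * g x).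
Proof.
move=> [mf [M fM]] [mg [N gN]]; split; first exact: measurable_funM.
by exists (M * N) => x; rewrite normrM ler_pM.
Qed.

Lemma bmeasN f : bmeas f -> bmeas (fun x => - f x).
Proof.
move=> [mf [M fM]]; split; first exact: measurableT_comp.
by exists M => x; rewrite normrN.
Qed.

Lemma bmeasB f g : bmeas f -> bmeas g -> bmeas (fun x => f x - g x).
Proof. by move=> bf bg; apply: bmeasD => //; exact: bmeasN. Qed.

Lemma bmeasX f n : bmeas f -> bmeas (fun x => f x ^+ n).
Proof.
move=> bf; elim: n => [|n ih]; first exact: bmeas_cst.
by under eq_fun do rewrite exprS; exact: bmeasM.
Qed.

Lemma bmeas_comp d' (S : measurableType d') (h : S -> T) f :
  measurable_fun [set: S] h -> bmeas f -> bmeas (fun x => f (h x)).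
Proof.
move=> mh [mf [M fM]]; split; last by exists M.
exact: (measurableT_comp mf mh).
Qed.

Lemma bmeas_prod (I : eqType) (s : seq I) (h : I -> T -> R) :
  (forall i, bmeas (h i)) -> bmeas (fun x => \prod_(i <- s) h i x).
Proof.
move=> bh; elim: s => [|i s ih].
  by under eq_fun do rewrite big_nil; exact: bmeas_cst.
by under eq_fun do rewrite big_cons; exact: bmeasM.
Qed.

Lemma bmeas_integrable (mu : {measure set T -> \bar R}) (A : set T) f :
  measurable A -> (mu A < +oo)%E -> bmeas f -> mu.-integrable A (EFin \o f).
Proof.
move=> mA fA [mf [M fM]]; apply: measurable_bounded_integrable => //.
  exact: measurable_funTS.
exists M; split; first exact: num_real.
by move=> N MN x _ /=; rewrite (le_trans (fM x))// ltW.
Qed.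

End closure.

(** * Parametric integrals and Fubini over sets of finite measure *)

Section fubini.
Context (d1 d2 : measure_display).
Context (T1 : measurableType d1) (T2 : measurableType d2).
Variable m2 : {sigma_finite_measure set T2 -> \bar R}.
Variable A2 : set T2.
Hypotheses (mA2 : measurable A2) (fA2 : (m2 A2 < +oo)%E).
Implicit Types F : T1 * T2 -> R.

Lemma bmeas_pair1 F x : bmeas F -> bmeas (fun y => F (x, y)).
Proof. by move=> bF; apply: bmeas_comp => //; exact: pair1_measurable. Qed.

Lemma bmeas_pair2 F y : bmeas F -> bmeas (fun x => F (x, y)).
Proof. by move=> bF; apply: bmeas_comp => //; exact: pair2_measurable. Qed.

Lemma bmeas_Rintegral F : bmeas F ->
  bmeas (fun x => \int[m2]_(y in A2) F (x, y)).
Proof.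
move=> bF; have [mF [M FM]] := bF; split; last first.
  exists (M * fine (m2 A2)) => x.
  have bFx := bmeas_pair1 x bF.
  apply: le_trans (le_normr_Rintegral _ _) _ => //.
    exact: bmeas_integrable.
  rewrite -Rintegral_cst//; apply: le_Rintegral => //.
    apply: bmeas_integrable => //; case: bFx => mFx _; split.
      exact: measurableT_comp.
    by exists M => y; rewrite normr_id.
  by apply: bmeas_integrable => //; exact: bmeas_cst.
(* Tonelli gives measurability for nonnegative integrands only. Adding the bound [M] reaches that
   case, and the resulting constant [M * fine (m2 A2)] is subtracted at the end. *)
pose G := EFin \o ((fun z : T1 * T2 => F z + M) \_ (setT `*` A2)).
have mD : measurable ([set: T1] `*` A2) by exact: measurableX.
have mG : measurable_fun setT G.
  apply: measurableT_comp => //; apply/(measurable_restrictT _ mD).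
  by apply: measurable_funTS; exact: measurable_funD.
have G0 z : (0 <= G z)%E.
  rewrite /G /= patchE; case: ifPn => // _; rewrite lee_fin.
  by have := FM z; rewrite ler_norml => /andP[]; lra.
have := measurable_fun_fubini_tonelli_F (m2 := m2) G mG G0.
rewrite (_ : fubini_F _ _ =
  fun x => (\int[m2]_(y in A2) F (x, y) + M * fine (m2 A2))%:E); last first.
  apply/funext => x; rewrite -Rintegral_cst// -RintegralD//; first last.
  - by apply: bmeas_integrable => //; exact: bmeas_cst.
  - by apply: bmeas_integrable => //; exact: bmeas_pair1.
  rewrite /Rintegral fineK; last first.
    apply: integrable_fin_num => //; apply: (bmeas_integrable (f := fun y => _)) => //.
    by apply: bmeasD; [exact: bmeas_pair1|exact: bmeas_cst].
  rewrite /fubini_F [RHS]integral_mkcond; apply: eq_integral => y _.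
  rewrite /G /= !patchE; rewrite (_ : (_ \in _ `*` _) = (y \in A2)).
    by case: ifP.
  by apply/idP/idP; rewrite !inE /=; [case|move=> ?; split].
move/measurable_EFinP => mI.
rewrite (_ : (fun x => _) = (fun x => (\int[m2]_(y in A2) F (x, y)
  + M * fine (m2 A2)) - M * fine (m2 A2))); last first.
  by apply/funext => x; rewrite addrK.
exact: measurable_funB.
Qed.

Variable m1 : {sigma_finite_measure set T1 -> \bar R}.
Variable A1 : set T1.
Hypotheses (mA1 : measurable A1) (fA1 : (m1 A1 < +oo)%E).

Let mA12 : measurable (A1 `*` A2). Proof. exact: measurableX. Qed.

Let fA12 : ((m1 \x m2)%E (A1 `*` A2) < +oo)%E.
Proof. by rewrite product_measure1E// lte_mul_pinfty// ge0_fin_numE. Qed.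

Let mem_prod x y : ((x, y) \in A1 `*` A2) = (x \in A1) && (y \in A2).
Proof.
by apply/idP/andP; rewrite !inE /=.
Qed.

Lemma bmeas_integrableX F : bmeas F ->
  (m1 \x m2)%E.-integrable (A1 `*` A2) (EFin \o F).
Proof. exact: bmeas_integrable. Qed.

Let integrable_prod F : bmeas F ->
  (m1 \x m2)%E.-integrable setT ((EFin \o F) \_ (A1 `*` A2)).
Proof.
by move=> bF; apply/(integrable_mkcond _ mA12); exact: bmeas_integrableX.
Qed.

(** Integrands are extended by zero to the whole product, where Fubini applies; the inner integral
    then vanishes for [x] outside [A1]. *)
Lemma Rintegral_prod F : bmeas F ->
  \int[(m1 \x m2)%E]_(z in A1 `*` A2) F z =
  \int[m1]_(x in A1) \int[m2]_(y in A2) F (x, y).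
Proof.
move=> bF; rewrite {1}/Rintegral integral_mkcond.
rewrite -(integral12_prod_meas1 (integrable_prod bF)).
rewrite [RHS]/Rintegral [in RHS]integral_mkcond; congr fine.
apply: eq_integral => x _; rewrite patchE /fubini_F.
under eq_integral do rewrite patchE mem_prod.
case: ifP => xA1 /=; last by rewrite integral0.
rewrite fineK; last first.
  apply: integrable_fin_num => //.
  exact: (bmeas_integrable mA2 fA2 (bmeas_pair1 x bF)).
by rewrite [in RHS]integral_mkcond.
Qed.

Lemma Rintegral_swap F : bmeas F ->
  \int[m1]_(x in A1) \int[m2]_(y in A2) F (x, y) =
  \int[m2]_(y in A2) \int[m1]_(x in A1) F (x, y).
Proof.
move=> bF; rewrite -Rintegral_prod// {1}/Rintegral integral_mkcond.
rewrite -(integral21_prod_meas1 (integrable_prod bF)).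
rewrite [RHS]/Rintegral [in RHS]integral_mkcond; congr fine.
apply: eq_integral => y _; rewrite patchE /fubini_G.
under eq_integral do rewrite patchE mem_prod andbC.
case: ifP => yA2 /=; last by rewrite integral0.
rewrite fineK; last first.
  apply: integrable_fin_num => //.
  exact: (bmeas_integrable mA1 fA1 (bmeas_pair2 y bF)).
by rewrite [in RHS]integral_mkcond.
Qed.

End fubini.

End bounded_measurable.

(** * Averages over the unit interval *)

Section average.
Context {R : realType}.

Notation mu := (@lebesgue_measure R).
Notation unitI := (@unit_interval R).

Let munit : measurable (unitI : set (measurableTypeR R)).
Proof. exact: measurable_itv. Qed.

Lemma lebesgue_measure_unit_interval : mu unitI = 1%E.
Proof. by rewrite lebesgue_measure_itv /= lte01 sube0. Qed.

Let funit : (mu unitI < +oo)%E.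
Proof. by rewrite lebesgue_measure_unit_interval ltry. Qed.

Definition avg (f : R -> R) : R := \int[mu]_(x in unitI) f x.

Lemma eq_avg f g : (forall x, unitI x -> f x = g x) -> avg f = avg g.
Proof. by move=> fg; apply: eq_Rintegral => x /set_mem; exact: fg. Qed.

Lemma avg_cst r : avg (fun=> r) = r.
Proof. by rewrite /avg Rintegral_cst// [X in fine X]lebesgue_measure_unit_interval mulr1. Qed.

Lemma avg_ge0 f : (forall x, 0 <= f x) -> 0 <= avg f.
Proof. by move=> f0; apply: Rintegral_ge0. Qed.

Notation bmeasR f := (@bmeas R _ (measurableTypeR R) f).

Lemma avgD f g : bmeasR f -> bmeasR g ->
  avg (fun x => f x + g x) = avg f + avg g.
Proof. by move=> bf bg; apply: RintegralD => //; exact: bmeas_integrable. Qed.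

Lemma avgB f g : bmeasR f -> bmeasR g ->
  avg (fun x => f x - g x) = avg f - avg g.
Proof. by move=> bf bg; apply: RintegralB => //; exact: bmeas_integrable. Qed.

Lemma avgZl r f : bmeasR f -> avg (fun x => r * f x) = r * avg f.
Proof. by move=> bf; apply: RintegralZl => //; exact: bmeas_integrable. Qed.

Lemma avgZr r f : bmeasR f -> avg (fun x => f x * r) = avg f * r.
Proof. by move=> bf; apply: RintegralZr => //; exact: bmeas_integrable. Qed.

Lemma bmeas_avg (d : measure_display) (T : measurableType d)
    (F : T * measurableTypeR R -> R) :
  bmeas F -> bmeas (fun x => avg (fun y => F (x, y))).
Proof. exact: bmeas_Rintegral. Qed.

Lemma avg_swap (F : measurableTypeR R * measurableTypeR R -> R) : bmeas F ->
  avg (fun x => avg (fun y => F (x, y))) =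
  avg (fun y => avg (fun x => F (x, y))).
Proof. exact: Rintegral_swap. Qed.

(** * Integrals over the cube, one coordinate at a time *)

Notation pm n := (power_measure mu n).

Lemma measurable_cube n :
  measurable (@cube R n : set (n.-tuple (measurableTypeR R))).
Proof.
rewrite (_ : @cube R n =
    \big[setI/setT]_(i < n) (@tnth n (measurableTypeR R) ^~ i @^-1` unitI)).
  apply: bigsetI_measurable => i _; rewrite -[X in measurable X]setTI.
  exact: measurable_tnth.
rewrite -bigcap_seq; apply/seteqP; split=> x /= h i; first by move=> _; exact: h.
by apply: h; rewrite /= mem_index_enum.
Qed.

Lemma power_measure_cube n : pm n (@cube R n) = 1%E.
Proof.
rewrite (power_measure_box mu (A := fun=> unitI))//.
by rewrite big1// => i _; exact: lebesgue_measure_unit_interval.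
Qed.

Notation bmeasT n f := (@bmeas R _ (n.-tuple (measurableTypeR R)) f).

(** The measure in dimension [n.+1] is the pushforward of a product along [tcons], and the cube
    pulls back to a rectangle: a change of variables followed by Fubini. *)
Lemma Rintegral_cubeS n (f : n.+1.-tuple (measurableTypeR R) -> R) :
  bmeas f ->
  \int[pm n.+1]_(x in @cube R n.+1) f x =
  avg (fun x => \int[pm n]_(t in @cube R n) f (tcons (x, t))).
Proof.
move=> bf.
have mc := @measurable_tcons _ (measurableTypeR R) n.
have bft : bmeas (fun z => f (tcons z)) by exact: bmeas_comp.
have preE : @tcons _ (measurableTypeR R) n @^-1` (@cube R n.+1) =
    unitI `*` @cube R n.
  apply/seteqP; split=> [[x t]|[x t]] /=.
    move=> h; split; first exact: (h ord0).
    by move=> i; have := h (lift ord0 i); rewrite tnthS.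
  move=> [h0 h] i; case: (unliftP ord0 i) => [j ->|->//].
  by rewrite tnthS.
have fc : (pm n (@cube R n) < +oo)%E by rewrite power_measure_cube ltry.
rewrite /avg -(Rintegral_prod (@measurable_cube n) fc munit funit bft).
have mf : measurable_fun setT (EFin \o f) by apply/measurable_EFinP; case: bf.
have intf : (mu \x pm n)%E.-integrable
    (@tcons _ (measurableTypeR R) n @^-1` (@cube R n.+1))
    ((EFin \o f) \o @tcons _ (measurableTypeR R) n).
  by rewrite preE; exact: (bmeas_integrableX (@measurable_cube n) fc munit funit bft).
rewrite /Rintegral -preE; congr fine.
exact: (integral_pushforward mc mf intf (@measurable_cube n.+1)).
Qed.

Lemma Rintegral_cube0 (f : 0.-tuple (measurableTypeR R) -> R) :
  bmeas f -> \int[pm 0]_(x in @cube R 0) f x = f [tuple].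
Proof.
move=> [mf _]; rewrite /Rintegral /= integral_dirac//; first last.
- by apply/measurable_EFinP; exact: measurable_funTS.
- exact: measurable_cube.
by rewrite diracE mem_set ?mul1e// => -[].
Qed.

(** An index beyond [n] reads the default 0, a constant function. Arbitrary [i] and [j] are allowed
    because [bmeas_prod] asks for every factor of the family, not only those listed. *)
Lemma bmeas_nth2 n (W : measurableTypeR R * measurableTypeR R -> R) i j :
  bmeas W -> bmeasT n (fun x => W (x`_i, x`_j)).
Proof.
move=> bW; apply: bmeas_comp bW.
have mn k : measurable_fun [set: n.-tuple (measurableTypeR R)]
    (fun x => x`_k : measurableTypeR R).
  have [kn|nk] := ltnP k n.
    rewrite (_ : (fun x => _) = (fun x => tnth x (Ordinal kn))).
      exact: measurable_tnth.
    by apply/funext => x; rewrite (tnth_nth 0).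
  rewrite (_ : (fun x => _) = (fun=> 0)); first exact: measurable_cst.
  by apply/funext => x; rewrite nth_default// size_tuple.
by apply/measurable_fun_pairP; split; exact: mn.
Qed.

Lemma eq_hom_density (H : sgraph) (W W' : R * R -> R) :
  (forall x y, unitI x -> unitI y -> W (x, y) = W' (x, y)) ->
  hom_density H W = hom_density H W'.
Proof.
move=> WW'; apply: eq_Rintegral => x /set_mem xc.
by apply: eq_bigr => uv _; apply: WW'; exact: xc.
Qed.

(** Pairs of natural numbers turn the product over an abstract edge set into one over an explicit
    list, once that list is known up to permutation. *)
Definition ranked_edges (H : sgraph) : seq (nat * nat) :=
  [seq (nat_of_ord (enum_rank uv.1), nat_of_ord (enum_rank uv.2)) |
    uv <- enum (edges H)].

Lemma hom_densityE (H : sgraph) n (W : R * R -> R) : #|H| = n ->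
  hom_density H W =
  \int[pm n]_(x in @cube R n) \prod_(ij <- ranked_edges H) W (x`_ij.1, x`_ij.2).
Proof.
move=> <-; apply: eq_Rintegral => x _; rewrite big_map big_enum /=.
by apply: eq_bigr => uv _; rewrite !(tnth_nth 0).
Qed.

End average.

(** * Edges of the two graphs *)

Lemma size_ranked_edges (H : sgraph) : size (ranked_edges H) = nedges H.
Proof. by rewrite size_map -cardE. Qed.

Lemma val_enum_rank_ord n (i : 'I_n) : enum_rank i = i :> nat.
Proof. by rewrite enum_rank_ord. Qed.

(** The enumeration of a sum type lists the left summand first, so left ranks are unchanged and
    right ranks are shifted by [#|S|]. *)
Lemma val_enum_rank_inl (S T : finType) (x : S) :
  enum_rank (inl x : S + T)%type = enum_rank x :> nat.
Proof.
have lt : (enum_rank x < #|{: S + T}|)%N.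
  by rewrite card_sum ltn_addr.
suff -> : inl x = enum_val (Ordinal lt) by rewrite enum_valK.
rewrite /enum_val (set_nth_default (inl x)) -?cardE//=.
rewrite enumT unlock /= /sum_enum nth_cat size_map -enumT -cardE ltn_ord.
by rewrite (nth_map x) -?cardE// nth_enum_rank.
Qed.

Lemma val_enum_rank_inr (S T : finType) (y : T) :
  enum_rank (inr y : S + T)%type = (#|S| + enum_rank y)%N :> nat.
Proof.
have lt : (#|S| + enum_rank y < #|{: S + T}|)%N.
  by rewrite card_sum ltn_add2l.
suff -> : inr y = enum_val (Ordinal lt) by rewrite enum_valK.
rewrite /enum_val (set_nth_default (inr y)) -?cardE//=.
rewrite enumT unlock /= /sum_enum nth_cat size_map -!enumT -cardE ltnNge leq_addr.
by rewrite addKn (nth_map y) -?cardE// nth_enum_rank.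
Qed.

(** The deleted edge joins 0 and 3, so 1 and 2 are the vertices of degree 3. *)
Lemma ranked_edges_K4_minus_edge : perm_eq (ranked_edges K4_minus_edge)
  [:: (0, 1); (0, 2); (1, 2); (1, 3); (2, 3)]%N.
Proof.
pose o k (kn : (k < 4)%N) : K4_minus_edge := @Ordinal 4 k kn.
have h : perm_eq (enum (edges K4_minus_edge))
  [:: (o 0 isT, o 1 isT); (o 0 isT, o 2 isT); (o 1 isT, o 2 isT);
      (o 1 isT, o 3 isT); (o 2 isT, o 3 isT)]%N.
  apply: uniq_perm => //; first exact: enum_uniq.
  move=> [u v]; rewrite mem_enum inE /= !val_enum_rank_ord.
  (* Equality of two-element sets becomes a boolean combination of memberships, which computes in
     each of the 16 cases. *)
  rewrite /adj /= finset.eqEsubset !finset.subUset !finset.sub1set !inE.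
  by case: u => -[|[|[|[|//]]]] ?; case: v => -[|[|[|[|//]]]] ?.
rewrite (permPl (perm_map _ h)) /=.
by rewrite !val_enum_rank_ord /=.
Qed.

Lemma ranked_edges_K3_disjoint_K2 : perm_eq (ranked_edges K3_disjoint_K2)
  [:: (0, 1); (0, 2); (1, 2); (3, 4)]%N.
Proof.
pose a k (kn : (k < 3)%N) : K3_disjoint_K2 := inl (@Ordinal 3 k kn).
pose b k (kn : (k < 2)%N) : K3_disjoint_K2 := inr (@Ordinal 2 k kn).
have h : perm_eq (enum (edges K3_disjoint_K2))
  [:: (a 0 isT, a 1 isT); (a 0 isT, a 2 isT); (a 1 isT, a 2 isT);
      (b 0 isT, b 1 isT)]%N.
  apply: uniq_perm => //; first exact: enum_uniq.
  move=> [u v]; rewrite mem_enum inE /=.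
  case: u v => u [] v //=; rewrite ?val_enum_rank_inl ?val_enum_rank_inr.
  - rewrite !val_enum_rank_ord.
    by case: u => -[|[|[|//]]] ?; case: v => -[|[|[|//]]] ?.
  - by rewrite !inE !xpair_eqE /= !andbF.
  - by rewrite !inE !xpair_eqE /= !andbF.
  - rewrite ltn_add2l !val_enum_rank_ord.
    by case: u => -[|[|//]] ?; case: v => -[|[|//]] ?.
rewrite (permPl (perm_map _ h)) /=.
by rewrite !val_enum_rank_inl !val_enum_rank_inr !val_enum_rank_ord card_ord.
Qed.

(** * Densities of a graphon and of its complement *)

Section densities.
Context {R : realType}.
Notation RR := (measurableTypeR R).
Notation unitI := (@unit_interval R).
Implicit Types (f g : RR -> R) (F G : RR * RR -> R).

(** Functions of sequences rather than tuples: for a concrete [n] this unfolds by computation to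
    nested averages, with the entries as named variables. *)
Fixpoint iavg n (f : seq R -> R) : R :=
  if n is n'.+1 then avg (fun x => iavg n' (fun s => f (x :: s))) else f [::].

Lemma Rintegral_cube n (f : seq R -> R) :
  bmeas (fun x : n.-tuple RR => f x) ->
  \int[power_measure (@lebesgue_measure R) n]_(x in @cube R n) f x = iavg n f.
Proof.
elim: n f => [|n IHn] f bf; first by rewrite Rintegral_cube0.
rewrite Rintegral_cubeS//=; apply: eq_avg => x _.
apply: (IHn (fun s => f (x :: s))).
apply: (bmeas_comp (h := fun t => tcons (x, t)) _ bf).
exact: measurableT_comp (@measurable_tcons _ RR n) (pair1_measurable _).
Qed.

Lemma hom_density_iavg (H : sgraph) n (l : seq (nat * nat)) F :
  #|H| = n -> perm_eq (ranked_edges H) l -> bmeas F ->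
  hom_density H F = iavg n (fun s => \prod_(ij <- l) F (s`_ij.1, s`_ij.2)).
Proof.
move=> Hn Hl bF; rewrite (hom_densityE _ Hn) -Rintegral_cube.
  by apply: eq_Rintegral => x _; exact: perm_big.
by apply: bmeas_prod => ij; exact: bmeas_nth2.
Qed.

Lemma bmeas_pair (d : measure_display) (T : measurableType d)
    (a b : T -> RR) F :
  measurable_fun setT a -> measurable_fun setT b -> bmeas F ->
  bmeas (fun t => F (a t, b t)).
Proof.
move=> ma mb bF; apply: bmeas_comp bF.
exact: measurable_fun_pair.
Qed.

Definition avg2 F : R := avg (fun x => avg (fun y => F (x, y))).

Lemma avg2D F G : bmeas F -> bmeas G ->
  avg2 (fun z => F z + G z) = avg2 F + avg2 G.
Proof.
move=> bF bG; rewrite /avg2 -avgD; [|exact: bmeas_avg..].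
by apply: eq_avg => x _; rewrite avgD//; exact: bmeas_pair1.
Qed.

Lemma avg2B F G : bmeas F -> bmeas G ->
  avg2 (fun z => F z - G z) = avg2 F - avg2 G.
Proof.
move=> bF bG; rewrite /avg2 -avgB; [|exact: bmeas_avg..].
by apply: eq_avg => x _; rewrite avgB//; exact: bmeas_pair1.
Qed.

Lemma avg2Z r F : bmeas F -> avg2 (fun z => r * F z) = r * avg2 F.
Proof.
move=> bF; rewrite /avg2 -avgZl; last exact: bmeas_avg.
by apply: eq_avg => x _; rewrite avgZl//; exact: bmeas_pair1.
Qed.

Lemma avg2_ge0 F : (forall z, 0 <= F z) -> 0 <= avg2 F.
Proof. by move=> F0; apply: avg_ge0 => x; exact: avg_ge0. Qed.

Lemma eq_avg2 F G : F =1 G -> avg2 F = avg2 G.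
Proof. by move=> /funext ->. Qed.

Lemma avg2_swap F : bmeas F -> avg2 F = avg2 (fun z => F (z.2, z.1)).
Proof. exact: avg_swap. Qed.

Lemma avg2_fst f : avg2 (fun z => f z.1) = avg f.
Proof. by apply: eq_avg => x _; exact: (avg_cst (f x)). Qed.

Lemma avg2_snd f : avg2 (fun z => f z.2) = avg f.
Proof. exact: (avg_cst (avg f)). Qed.

(** * Edge, cherry and triangle densities *)

Section graphon.
Variable W : RR * RR -> R.
Hypothesis bW : bmeas W.
Hypothesis symW : forall x y, W (x, y) = W (y, x).

Definition deg x : R := avg (fun y => W (x, y)).
Definition codeg z : R := avg (fun t => W (z.1, t) * W (z.2, t)).
Definition edge_density := avg2 W.
(** The density of the path with two edges, integrated from its middle vertex. *)
Definition cherry_density := avg (fun x => deg x ^+ 2).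
Definition triangle_density := avg2 (fun z => W z * codeg z).

Lemma bmeas_deg : bmeas deg.
Proof. exact: bmeas_avg. Qed.

Lemma bmeas_codeg : bmeas codeg.
Proof.
apply: (bmeas_avg (F := fun z => W (z.1.1, z.2) * W (z.1.2, z.2))).
by apply: bmeasM; apply: bmeas_pair => //; exact: measurableT_comp.
Qed.

(** Once the adjacent vertices 1 and 2 are placed at [z], vertices 0 and 3 are independent and each
    contributes a factor [codeg z]. *)
Lemma hom_density_K4_minus_edge :
  hom_density K4_minus_edge W = avg2 (fun z => W z * codeg z ^+ 2).
Proof.
have K4 : #|K4_minus_edge| = 4 by rewrite card_ord.
rewrite (hom_density_iavg K4 ranked_edges_K4_minus_edge bW).
(* What is left after integrating out vertex 3, with [z] the pair of points at vertices 1 and 2 and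
   [t] the point at vertex 0. *)
pose P z t := W z * codeg z * (W (z.1, t) * W (z.2, t)).
have bP : bmeas (fun u : (RR * RR) * RR => P u.1 u.2).
  apply: bmeasM; last first.
    by apply: bmeasM; apply: bmeas_pair => //; exact: measurableT_comp.
  apply: (bmeas_comp (h := fst) _ (f := fun z => W z * codeg z)) => //.
  by apply: bmeasM => //; exact: bmeas_codeg.
transitivity (avg (fun t => avg2 (fun z => P z t))).
  apply: eq_avg => t _; apply: eq_avg => x _; apply: eq_avg => y _ /=.
  transitivity (avg (fun v => W (x, y) * (W (x, t) * W (y, t)) *
                              (W (x, v) * W (y, v)))).
    apply: eq_avg => v _; rewrite !big_cons big_nil /= (symW t x) (symW t y).
    ring.
  rewrite avgZl; last by apply: bmeasM; exact: bmeas_pair1.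
  rewrite /P /= -/(codeg (x, y)); ring.
(* Vertex 0 is integrated outermost; two swaps, past [x] and then past [y], bring it innermost. *)
rewrite (avg_swap (F := fun z => avg (fun y => P (z.2, y) z.1))); last first.
  apply: (bmeas_avg (F := fun u => P (u.1.2, u.2) u.1.1)).
  apply: (bmeas_comp (h := fun u => ((u.1.2, u.2), u.1.1)) _ bP).
  apply: measurable_fun_pair; last exact: measurableT_comp.
  by apply: measurable_fun_pair => //; exact: measurableT_comp.
apply: eq_avg => x _.
rewrite (avg_swap (F := fun z => P (x, z.2) z.1)); last first.
  apply: (bmeas_comp (h := fun u => ((x, u.2), u.1)) _ bP).
  apply: measurable_fun_pair => //.
  by apply: measurable_fun_pair => //; exact: measurable_cst.
apply: eq_avg => y _; rewrite /P /= avgZl; last first.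
  by apply: bmeasM; exact: bmeas_pair1.
by rewrite -/(codeg (x, y)) expr2 mulrA.
Qed.

(** The components share no variable. The factors on the right are pushed inside the averages until
    both sides are the same fivefold average. *)
Lemma hom_density_K3_disjoint_K2 :
  hom_density K3_disjoint_K2 W = triangle_density * edge_density.
Proof.
have K5 : #|K3_disjoint_K2| = 5 by rewrite card_sum !card_ord.
rewrite (hom_density_iavg K5 ranked_edges_K3_disjoint_K2 bW).
have bcW := bmeasM bW bmeas_codeg.
rewrite /triangle_density /avg2 -avgZr; last exact: (bmeas_avg bcW).
apply: eq_avg => x _; rewrite -avgZr; last exact: (bmeas_pair1 x bcW).
apply: eq_avg => y _; rewrite -mulrA -avgZr /=; last first.
  by apply: bmeasM; exact: bmeas_pair1.
rewrite -avgZl; last first.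
  apply: bmeasM (bmeas_cst _ _).
  by apply: bmeasM; exact: bmeas_pair1.
apply: eq_avg => z _.
rewrite mulrA -avgZl; last exact: bmeas_avg.
apply: eq_avg => u _; rewrite -avgZl; last exact: bmeas_pair1.
by apply: eq_avg => v _; rewrite !big_cons big_nil /=; ring.
Qed.

Lemma avg2_Wdeg : avg2 (fun z => W z * deg z.1) = cherry_density.
Proof.
by apply: eq_avg => x _; rewrite /= avgZr ?expr2//; exact: bmeas_pair1.
Qed.

Let bdeg1 : bmeas (fun z : RR * RR => deg z.1).
Proof. by apply: bmeas_comp bmeas_deg. Qed.

Let bdeg2 : bmeas (fun z : RR * RR => deg z.2).
Proof. by apply: bmeas_comp bmeas_deg. Qed.

Lemma avg2_Wdeg2 : avg2 (fun z => W z * deg z.2) = cherry_density.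
Proof.
rewrite avg2_swap; last exact: bmeasM.
by rewrite -avg2_Wdeg; apply: eq_avg2 => -[x y] /=; rewrite symW.
Qed.

(** Both sides count cherries: with the common neighbour [t] fixed, averaging over [y] leaves
    [W (x, t) * deg t]. *)
Lemma avg2_codeg : avg2 codeg = cherry_density.
Proof.
have bt u : bmeas (fun x => W (x, u)) by exact: bmeas_pair2.
transitivity (avg (fun x => avg (fun t => W (x, t) * deg t))).
  apply: eq_avg => x _; rewrite (avg_swap (F := fun z => W (x, z.2) * W (z.1, z.2))).
    apply: eq_avg => t _; rewrite /= avgZl//; congr (_ * _).
    by apply: eq_avg => y _ /=; rewrite symW.
  apply: bmeasM => //; first by apply: bmeas_pair => //; exact: measurable_cst.
  exact: bmeas_pair.
exact: avg2_Wdeg2.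
Qed.

(** The variance of the degree is nonnegative. *)
Lemma cherry_density_ge : edge_density ^+ 2 <= cherry_density.
Proof.
have : 0 <= avg (fun x => (deg x - edge_density) ^+ 2).
  by apply: avg_ge0 => x; exact: sqr_ge0.
rewrite (_ : avg _ = cherry_density - edge_density ^+ 2) ?subr_ge0//.
have bd := bmeas_deg.
transitivity (avg (fun x => deg x ^+ 2 - (2 * edge_density * deg x -
                                          edge_density ^+ 2))).
  by apply: eq_avg => x _; ring.
have b1 : bmeas (fun x => 2 * edge_density * deg x).
  by apply: bmeasM => //; exact: bmeas_cst.
have b2 : bmeas (fun _ : RR => edge_density ^+ 2) by exact: bmeas_cst.
rewrite avgB; [|exact: bmeasX|exact: bmeasB].
rewrite avgB// avgZl// avg_cst.
rewrite -/cherry_density (_ : avg deg = edge_density)//; ring.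
Qed.

(** Expansion of the weighted square. The constant [l] stays free, to be chosen later in terms of
    the edge density. *)
Lemma avg2_W_codeg_ge l : 0 <= avg2 (fun z => W z * (codeg z - l) ^+ 2) ->
  2 * l * triangle_density - l ^+ 2 * edge_density <=
  avg2 (fun z => W z * codeg z ^+ 2).
Proof.
have bc := bmeas_codeg.
rewrite (_ : avg2 _ = avg2 (fun z => W z * codeg z ^+ 2) -
  (2 * l * triangle_density - l ^+ 2 * edge_density)); first by rewrite subr_ge0.
transitivity (avg2 (fun z => W z * codeg z ^+ 2 -
    (2 * l * (W z * codeg z) - l ^+ 2 * W z))).
  by apply: eq_avg2 => z; ring.
have bWc := bmeasM bW bc.
have b1 : bmeas (fun z => 2 * l * (W z * codeg z)).
  by apply: bmeasM => //; exact: bmeas_cst.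
have b2 : bmeas (fun z => l ^+ 2 * W z).
  by apply: bmeasM => //; exact: bmeas_cst.
rewrite avg2B; [|by apply: bmeasM => //; exact: bmeasX|exact: bmeasB].
by rewrite avg2B// !avg2Z.
Qed.

End graphon.

(** * Densities of [1 - W] *)

Section complement.
Variable W : RR * RR -> R.
Hypothesis bW : bmeas W.
Hypothesis symW : forall x y, W (x, y) = W (y, x).
Let U z := 1 - W z.

Lemma bmeas_compl : bmeas U.
Proof. by apply: bmeasB => //; exact: bmeas_cst. Qed.

Lemma edge_density_compl : edge_density U = 1 - edge_density W.
Proof.
have b0 : bmeas (fun _ : RR * RR => 1 : R) by exact: bmeas_cst.
by rewrite /edge_density (avg2B b0 bW) /avg2 !avg_cst.
Qed.

Lemma codeg_compl z :
  codeg U z = 1 - deg W z.1 - deg W z.2 + codeg W z.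
Proof.
rewrite /codeg /U /deg.
have b1 := bmeas_pair1 z.1 bW; have b2 := bmeas_pair1 z.2 bW.
transitivity (avg (fun t => 1 - W (z.1, t) - W (z.2, t) +
                            W (z.1, t) * W (z.2, t))).
  by apply: eq_avg => t _; ring.
have b0 : bmeas (fun _ : RR => 1 : R) by exact: bmeas_cst.
have b3 := bmeasB b0 b1; have b4 := bmeasB b3 b2; have b5 := bmeasM b1 b2.
by rewrite avgD// !avgB// avg_cst.
Qed.

Let bdeg1 : bmeas (fun z : RR * RR => deg W z.1).
Proof. by apply: bmeas_comp (bmeas_deg bW). Qed.

Let bdeg2 : bmeas (fun z : RR * RR => deg W z.2).
Proof. by apply: bmeas_comp (bmeas_deg bW). Qed.

Let avgdeg : avg (deg W) = edge_density W. Proof. by []. Qed.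

(** The density of triples with one pair joined in [W] and the other two in [U]. Its nonnegativity
    is the bound T >= 2 s - e. *)
Lemma avg2_W_codeg_compl : avg2 (fun z => W z * codeg U z) =
  edge_density W - 2 * cherry_density W + triangle_density W.
Proof.
transitivity (avg2 (fun z => W z - W z * deg W z.1 - W z * deg W z.2 +
                             W z * codeg W z)).
  by apply: eq_avg2 => z; rewrite codeg_compl; ring.
have b1 := bmeasM bW bdeg1; have b2 := bmeasM bW bdeg2.
have b3 := bmeasM bW (bmeas_codeg bW).
have b4 := bmeasB bW b1; have b5 := bmeasB b4 b2.
rewrite avg2D// !avg2B// avg2_Wdeg// avg2_Wdeg2//.
rewrite -/(edge_density W) -/(triangle_density W); ring.
Qed.

Lemma avg2_codeg_compl : avg2 (codeg U) =
  1 - 2 * edge_density W + cherry_density W.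
Proof.
rewrite (eq_avg2 codeg_compl).
have b0 : bmeas (fun _ : RR * RR => 1 : R) by exact: bmeas_cst.
have b1 := bmeasB b0 bdeg1; have b2 := bmeasB b1 bdeg2.
rewrite avg2D//; last exact: bmeas_codeg.
rewrite !avg2B// avg2_codeg// avg2_fst avg2_snd avgdeg.
rewrite /avg2 !avg_cst; ring.
Qed.

(** Goodman's identity, obtained by expanding one edge of the triangle as [1 - W]. *)
Lemma triangle_density_compl : triangle_density U =
  1 - 3 * edge_density W + 3 * cherry_density W - triangle_density W.
Proof.
transitivity (avg2 (fun z => codeg U z - W z * codeg U z)).
  by apply: eq_avg2 => z; rewrite /U; ring.
have bc := bmeas_codeg bmeas_compl; have b1 := bmeasM bW bc.
rewrite (avg2B bc b1) avg2_W_codeg_compl avg2_codeg_compl; ring.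
Qed.

End complement.

End densities.

(** * The polynomial inequality *)

Section numeric.
Context {R : realFieldType}.
Implicit Types p q e s T D : R.

(** The conclusion is the commonality inequality multiplied by [8 * q ^+ 3], with [5 * p ^+ 4]
    replaced by its value [64 / 5 * q ^+ 4]. *)
Lemma density_bound_small p q e s T D :
    5 / 9 < p -> p < 14 / 25 -> q = 1 - p ->
    0 <= e -> e <= 1 -> e ^+ 2 <= s -> 2 * s - e <= T ->
    (forall l, 2 * l * T - l ^+ 2 * e <= D) ->
    3 * p ^+ 2 - 16 * p + 8 = 0 -> e <= 16 / 25 ->
  q ^+ 3 * (8 / 5 * p + 2 * q) <=
  D * (5 / 8 / q) + 2 * (1 - e) * (1 - 3 * e + 3 * s - T).
Proof.
move=> p0 p1 qE e0 e1 es sT DT pE ele.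
have q_gt0 : 0 < q by lra.
(* This choice of l cancels the coefficient of T. *)
have /(_ (8 / 5 * q * (1 - e))) hD := DT.
have hD' : 2 * (1 - e) * T - 8 / 5 * q * (1 - e) ^+ 2 * e <= D * (5 / 8 / q).
  rewrite -ler_pdivrMr ?divr_gt0//; apply: le_trans hD.
  by rewrite le_eqVlt; apply/orP; left; apply/eqP; field; rewrite gt_eqF.
have hs : 2 * (1 - e) * (3 * e ^+ 2) <= 2 * (1 - e) * (3 * s).
  by rewrite ler_wpM2l//; lra.
(* These match the coefficients of e^3 and e^2 in the identity below. What remains is affine in e
   and a multiple of 3 p^2 - 16 p + 8, hence zero. *)
pose b := 6 + 8 / 5 * q; pose a := 12 + 16 / 5 * q - 2 * p * b.
(* The affine factor is positive for e <= 16/25 but negative near e = 1, whence the separate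
   treatment of large e. *)
have key : 0 <= (e - p) ^+ 2 * (a - b * e).
  by rewrite mulr_ge0 ?sqr_ge0// /a /b qE; nra.
have : 2 * (1 - e) * (1 - 3 * e + 3 * e ^+ 2) - 8 / 5 * q * (1 - e) ^+ 2 * e
    - q ^+ 3 * (8 / 5 * p + 2 * q) = (e - p) ^+ 2 * (a - b * e) +
  (3 * p ^+ 2 - 16 * p + 8) * (4 / 5 * p - 6 / 5 * p ^+ 2 +
     (8 / 5 * p - 6 / 5) * e).
  by rewrite /a /b qE; field.
rewrite pE mul0r addr0; lra.
Qed.

Lemma density_bound_large p q e s T D :
    5 / 9 < p -> p < 14 / 25 -> q = 1 - p ->
    0 <= e -> e <= 1 -> e ^+ 2 <= s -> 2 * s - e <= T ->
    (forall l, 2 * l * T - l ^+ 2 * e <= D) ->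
    16 / 25 <= e ->
  q ^+ 3 * (8 / 5 * p + 2 * q) <=
  D * (5 / 8 / q) + 2 * (1 - e) * (1 - 3 * e + 3 * s - T).
Proof.
move=> p0 p1 qE e0 e1 es sT DT ege.
have q_gt0 : 0 < q by lra.
(* The best [l] is T / e, which equals 2 e - 1 when T takes its lower bound 2 e^2 - e. *)
have hD := DT (2 * e - 1).
pose k := 5 / 8 / q.
have k0 : 0 < k by rewrite /k !divr_gt0.
rewrite -/k.
have hDk := ler_wpM2r (ltW k0) hD.
have kb : 7 / 5 <= k.
  by rewrite /k ler_pdivlMr// qE; lra.
(* This is the total coefficient of T. With k >= 7/5 it is nonnegative as soon as e >= 12/19, just
   below 16/25, so the lower bound on T may be inserted. *)
have hc : 0 <= 2 * (2 * e - 1) * k - 2 * (1 - e) by nra.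
have hs : 2 * (1 - e) * (3 * e ^+ 2) <= 2 * (1 - e) * (3 * s).
  by rewrite ler_wpM2l//; lra.
have hT := ler_wpM2l hc (le_trans _ sT : 2 * e ^+ 2 - e <= T).
have {}hT : (2 * (2 * e - 1) * k - 2 * (1 - e)) * (2 * e ^+ 2 - e) <=
    (2 * (2 * e - 1) * k - 2 * (1 - e)) * T by apply: hT; lra.
have rhs : q ^+ 3 * (8 / 5 * p + 2 * q) <= 4 / 25.
  have q3 : q ^+ 3 <= (4 / 9) ^+ 3.
    by apply: lerXn2r; rewrite ?nnegrE; lra.
  have q30 : 0 <= q ^+ 3 by rewrite exprn_ge0// ltW.
  have pq : 8 / 5 * p + 2 * q <= 16 / 9 by lra.
  apply: (le_trans (ler_wpM2l q30 pq)).
  apply: (@le_trans _ _ ((4 / 9) ^+ 3 * (16 / 9))); last by lra.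
  by rewrite ler_wpM2r//; lra.
(* The value at s = e^2 and T = 2 e^2 - e, where 1 - 3 e + 3 s - T becomes (1 - e)^2. *)
have lhs : 4 / 25 <= k * e * (2 * e - 1) ^+ 2 + 2 * (1 - e) ^+ 3.
  have h0 : 0 <= (k - 7 / 5) * (e * (2 * e - 1) ^+ 2).
    by rewrite mulr_ge0 ?mulr_ge0 ?sqr_ge0//; lra.
  (* The cubic minus 4/25 is a nonnegative combination of [h1], [h2], e - 16/25 and a positive
     constant. *)
  have h1 : 0 <= (e - 16 / 25) ^+ 2 * e by rewrite mulr_ge0// sqr_ge0.
  have h2 : 0 <= (e - 16 / 25) ^+ 2 by rewrite sqr_ge0.
  suff : 4 / 25 <= 7 / 5 * e * (2 * e - 1) ^+ 2 + 2 * (1 - e) ^+ 3 by lra.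
  lra.
lra.
Qed.

Lemma density_bound p q e s T D :
    5 / 9 < p -> p < 14 / 25 -> q = 1 - p ->
    0 <= e -> e <= 1 -> e ^+ 2 <= s -> 2 * s - e <= T ->
    (forall l, 2 * l * T - l ^+ 2 * e <= D) ->
    3 * p ^+ 2 - 16 * p + 8 = 0 ->
  p / 5 + q / 4 <= D / (5 * p ^+ 4) +
    (1 - 3 * e + 3 * s - T) * (1 - e) / (4 * q ^+ 3).
Proof.
move=> p0 p1 qE e0 e1 es sT DT pE.
have q_gt0 : 0 < q by lra.
have p_gt0 : 0 < p by lra.
have pq : 5 * p ^+ 2 = 8 * q ^+ 2.
  have -> : 8 * q ^+ 2 = 5 * p ^+ 2 + (3 * p ^+ 2 - 16 * p + 8).
    by rewrite qE; ring.
  by rewrite pE addr0.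
have bound : q ^+ 3 * (8 / 5 * p + 2 * q) <=
    D * (5 / 8 / q) + 2 * (1 - e) * (1 - 3 * e + 3 * s - T).
  have [ele|/ltW ege] := leP e (16 / 25).
    exact: density_bound_small.
  exact: (density_bound_large p0 p1).
(* Squaring the relation between p^2 and q^2 leaves q alone in the denominators. *)
have pq4 : 5 * p ^+ 4 = 64 / 5 * q ^+ 4.
  have p2 : p ^+ 2 = 8 / 5 * q ^+ 2 by lra.
  by rewrite -[4%N]/(2 * 2)%N !exprM p2; field.
rewrite pq4 -subr_ge0.
rewrite (_ : _ - _ = (D * (5 / 8 / q) + 2 * (1 - e) * (1 - 3 * e + 3 * s - T)
  - q ^+ 3 * (8 / 5 * p + 2 * q)) / (8 * q ^+ 3)).
  by rewrite divr_ge0 ?subr_ge0// mulr_ge0// exprn_ge0// ltW.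
by field; rewrite gt_eqF.
Qed.

End numeric.

(** * Commonality *)

Section graphon_extension.
Context {R : realType}.
Notation RR := (measurableTypeR R).
Notation unitI := (@unit_interval R).
Variable W : R * R -> R.
Hypothesis gW : graphon W.

(** A graphon is constrained on the unit square only. Extension by zero makes symmetry, the bounds
    and measurability hold everywhere and leaves the densities unchanged. *)
Definition graphon_ext : RR * RR -> R := W \_ (unitI `*` unitI).

Let mem_square x y : ((x, y) \in unitI `*` unitI) = (x \in unitI) && (y \in unitI).
Proof. by apply/idP/andP; rewrite !inE. Qed.

Lemma graphon_ext_in x y : unitI x -> unitI y -> graphon_ext (x, y) = W (x, y).
Proof. by move=> xI yI; rewrite /graphon_ext patchE mem_square !mem_set. Qed.

Lemma graphon_ext_sym x y : graphon_ext (x, y) = graphon_ext (y, x).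
Proof.
rewrite /graphon_ext !patchE !mem_square andbC.
case: ifP => // /andP[/set_mem yI /set_mem xI].
by case: gW => _ symW _; exact: symW.
Qed.

Lemma graphon_ext_itv z : 0 <= graphon_ext z <= 1.
Proof.
case: z => x y; rewrite /graphon_ext patchE mem_square.
case: ifP => [/andP[/set_mem xI /set_mem yI]|_]; last by rewrite lexx ler01.
by case: gW => _ _; exact.
Qed.

Lemma bmeas_graphon_ext : bmeas graphon_ext.
Proof.
split.
  have mI : measurable (unitI : set RR) by exact: measurable_itv.
  by apply/(measurable_restrictT _ (measurableX mI mI)); case: gW.
by exists 1 => z; have /andP[W0 W1] := graphon_ext_itv z; rewrite ger0_norm.
Qed.

End graphon_extension.

Theorem theorem1p7 (R : realType) (p : R) (hp : p = (8 - 2 * Num.sqrt 10) / 3) :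
  common p (1 - p) K4_minus_edge K3_disjoint_K2.
Proof.
have s2 : Num.sqrt (10 : R) ^+ 2 = 10 by rewrite sqr_sqrtr.
have s0 : 0 <= Num.sqrt (10 : R) by exact: sqrtr_ge0.
(* These two bounds on the root are exactly 5/9 < p < 14/25. *)
have s1 : 79 / 25 < Num.sqrt (10 : R) by nra.
have s3 : Num.sqrt (10 : R) < 19 / 6 by nra.
have p0 : 5 / 9 < p by lra.
have p1 : p < 14 / 25 by lra.
have pE : 3 * p ^+ 2 - 16 * p + 8 = 0.
  transitivity (4 / 3 * (Num.sqrt (10 : R) ^+ 2 - 10)); first by rewrite hp; field.
  by rewrite s2 subrr mulr0.
have e1 : nedges K4_minus_edge = 5%N.
  by rewrite -size_ranked_edges (perm_size ranked_edges_K4_minus_edge).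
have e2 : nedges K3_disjoint_K2 = 4%N.
  by rewrite -size_ranked_edges (perm_size ranked_edges_K3_disjoint_K2).
split; rewrite ?e1 ?e2//; [by apply/andP; split; lra..|by rewrite addrC subrK|].
move=> W1 W2 gW1 gW2 W12 /=.
(* [U] agrees with [W2] on the unit square and equals 1 elsewhere, so it is nonnegative
   everywhere. *)
pose W := graphon_ext W1; pose U z := 1 - W z.
have bW : bmeas W := bmeas_graphon_ext gW1.
have bU : bmeas U := bmeas_compl bW.
have symW := graphon_ext_sym gW1 : forall x y, W (x, y) = W (y, x).
have W_ge0 z : 0 <= W z by have /andP[] := graphon_ext_itv gW1 z.
have U_ge0 z : 0 <= U z.
  by rewrite subr_ge0; have /andP[] := graphon_ext_itv gW1 z.
rewrite (eq_hom_density _ (W' := W)); last first.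
  by move=> x y xI yI; rewrite /W graphon_ext_in.
rewrite (eq_hom_density _ (W := W2) (W' := U)); last first.
  by move=> x y xI yI; rewrite /U /W graphon_ext_in// -(W12 _ _ xI yI) addrC addKr.
rewrite hom_density_K4_minus_edge// hom_density_K3_disjoint_K2//.
rewrite triangle_density_compl// edge_density_compl//.
have codegU_ge0 z : 0 <= codeg U z by apply: avg_ge0 => t; rewrite mulr_ge0.
apply: density_bound => //.
- exact: avg2_ge0.
- by rewrite -subr_ge0 -edge_density_compl//; exact: avg2_ge0.
- exact: cherry_density_ge.
(* T >= 2 s - e, from the density of an edge of [W] completed by two edges of [U]. *)
- have : 0 <= avg2 (fun z => W z * codeg U z).
    by apply: avg2_ge0 => z; rewrite mulr_ge0.
  rewrite avg2_W_codeg_compl//; lra.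
- move=> l; apply: avg2_W_codeg_ge => //; apply: avg2_ge0 => z.
  by rewrite mulr_ge0 ?sqr_ge0.
Qed.
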